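(* Let $\mathcal C$ be a strict rigid category and $R\colon\mathcal C\to\mathcal C$ a strict monoidal functor. The set of isomorphism classes $$\mathrm{Pic}\,\mathsf Z(\mathcal C_R)=\{[\alpha]\mid\alpha\in\mathsf Z(\mathcal C_R)\text{ is }\mathcal C\text{-invertible}\}$$ together with the ternary operation $\langle[\alpha],[\beta],[\gamma]\rangle=[\alpha\otimes\beta^\vee\otimes\gamma]$ for $[\alpha],[\beta],[\gamma]\in\mathrm{Pic}\,\mathsf Z(\mathcal C_R)$ is a heap.
   Context: A heap is a set $G$ with a ternary operation such that $\langle g,h,\langle i,j,k\rangle\rangle=\langle\langle g,h,i\rangle,j,k\rangle$ and $\langle g,g,h\rangle=h=\langle h,g,g\rangle$ for all elements; the empty set is allowed. Monoidal categories are strict. A rigid category (chosen left duals $X^\vee$ with $\mathrm{ev}^l_X\colon X^\vee\otimes X\to1$, $\mathrm{coev}^l_X\colon1\to X\otimes X^\vee$, and right duals) is strict rigid if left and right dualising $\mathcal C\to\mathcal C^{\mathrm{op},\otimes\text{-}\mathrm{op}}$ are strict monoidal and mutually inverse. The right twisted centre $\mathsf Z(\mathcal C_R)$ has objects $(A,\sigma_{A,-})$ with natural isomorphisms $\sigma_{A,Y}\colon A\otimes R(Y)\to Y\otimes A$ satisfying $\sigma_{A,Y\otimes W}=(\mathrm{id}_Y\otimes\sigma_{A,W})(\sigma_{A,Y}\otimes\mathrm{id}_{R(W)})$; morphisms are morphisms of $\mathcal C$ commuting with the half-braidings. An object is $\mathcal C$-invertible if its underlying object of $\mathcal C$ is invertible,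 i.e. has invertible left evaluation and coevaluation. The left dual $A^\vee$ of $(A,\sigma_{A,-})$ carries $$\sigma_{A^\vee,Y}=(\mathrm{ev}^l_A\otimes\mathrm{id})(\mathrm{id}_{A^\vee}\otimes\sigma_{A,Y}^{-1}\otimes\mathrm{id}_{A^\vee})(\mathrm{id}_{A^\vee\otimes Y}\otimes\mathrm{coev}^l_A)\colon A^\vee\otimes Y\to R(Y)\otimes A^\vee.$$ The object $\alpha\otimes\beta^\vee\otimes\gamma$ of $\mathsf Z(\mathcal C_R)$ has half-braiding $(\sigma_{\alpha,Y}\otimes\mathrm{id}\otimes\mathrm{id})(\mathrm{id}\otimes\sigma_{\beta^\vee,Y}\otimes\mathrm{id})(\mathrm{id}\otimes\mathrm{id}\otimes\sigma_{\gamma,Y})$. *)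

(* Defs.v *)
From mathcomp Require Import ssreflect ssrfun.
From Stdlib Require Import ProofIrrelevance.

Set Implicit Arguments.
Unset Strict Implicit.
Unset Printing Implicit Defensive.

Declare Scope cat_scope.
Delimit Scope cat_scope with cat.
Local Open Scope cat_scope.

Record category : Type := Category {
  ob :> Type;
  hom : ob -> ob -> Type;
  idm : forall X, hom X X;
  comp : forall X Y Z, hom Y Z -> hom X Y -> hom X Z;
  comp1m : forall X Y (f : hom X Y), comp (idm Y) f = f;
  compm1 : forall X Y (f : hom X Y), comp f (idm X) = f;
  compA : forall X Y Z W (h : hom Z W) (g : hom Y Z) (f : hom X Y),
    comp h (comp g f) = comp (comp h g) f
}.
Arguments hom {c} _ _.
Arguments idm {c} X.
Arguments comp {c X Y Z} _ _.

Notation "g ∘ f" := (comp g f) (at level 40, left associativity) : cat_scope.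

Definition is_inverse (C : category) (X Y : C) (f : hom X Y) (g : hom Y X) : Prop :=
  g ∘ f = idm X /\ f ∘ g = idm Y.

Definition is_iso (C : category) (X Y : C) (f : hom X Y) : Prop :=
  exists g, is_inverse f g.

Definition isomorphic (C : category) (X Y : C) : Prop :=
  exists f : hom X Y, is_iso f.

(* Strictness makes objects such as (X ⊗ Y) ⊗ Z and X ⊗ (Y ⊗ Z) equal, but not
   convertible.  Hence [f ≡ g] says that [f] and [g] are the same arrow,
   including source and target, and [castm] retypes an arrow along equalities
   of objects. *)
Inductive same_arrow (C : category) (X Y : C) (f : hom X Y) :
    forall X' Y' : C, hom X' Y' -> Prop :=
  SameArrow : same_arrow f f.
Notation "f ≡ g" := (same_arrow f g) (at level 70, no associativity) : cat_scope.

Definition castm (C : category) (X X' Y Y' : C) (f : hom X Y)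
    (eX : X = X') (eY : Y = Y') : hom X' Y' :=
  match eX in _ = X1, eY in _ = Y1 return hom X1 Y1 with
  | erefl, erefl => f
  end.
(* The target type must be known before the equalities are inferred. *)
Arguments castm {C X X' Y Y'} f & eX eY.

Definition comp_cast (C : category) (X Y Y' Z : C)
    (g : hom Y' Z) (f : hom X Y) (e : Y = Y') : hom X Z := g ∘ castm f erefl e.

Record strict_monoidal_category : Type := StrictMonoidalCategory {
  smc_cat :> category;
  unit_ob : smc_cat;
  tens : smc_cat -> smc_cat -> smc_cat;
  tensm : forall X X' Y Y' : smc_cat,
    hom X X' -> hom Y Y' -> hom (tens X Y) (tens X' Y');
  tensm_id : forall X Y : smc_cat, tensm (idm X) (idm Y) = idm (tens X Y);
  tensm_comp : forall (X X' X'' Y Y' Y'' : smc_cat) (f : hom X X')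
      (f' : hom X' X'') (g : hom Y Y') (g' : hom Y' Y''),
    tensm (f' ∘ f) (g' ∘ g) = tensm f' g' ∘ tensm f g;
  tensA : forall X Y Z : smc_cat, tens X (tens Y Z) = tens (tens X Y) Z;
  tens1o : forall X : smc_cat, tens unit_ob X = X;
  tenso1 : forall X : smc_cat, tens X unit_ob = X;
  tensmA : forall (X X' Y Y' Z Z' : smc_cat)
      (f : hom X X') (g : hom Y Y') (h : hom Z Z'),
    tensm f (tensm g h) ≡ tensm (tensm f g) h;
  tensm1m : forall (X Y : smc_cat) (f : hom X Y), tensm (idm unit_ob) f ≡ f;
  tensmm1 : forall (X Y : smc_cat) (f : hom X Y), tensm f (idm unit_ob) ≡ f
}.
Arguments unit_ob {s}.
Arguments tens {s} _ _.
Arguments tensm {s X X' Y Y'} _ _.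

Notation "X ⊗ Y" := (tens X Y) (at level 38, left associativity) : cat_scope.
Notation "f ⊠ g" := (tensm f g) (at level 38, left associativity) : cat_scope.

(* [g ⊚ f] and [⌈f⌉] insert the casts that are invisible on paper; the
   equalities of objects follow from associativity and unitality of ⊗. *)
Ltac strictness :=
  solve [ reflexivity | rewrite ?tens1o ?tenso1 ?tensA; reflexivity ].
Notation "g ⊚ f" := (comp_cast g f ltac:(strictness))
  (at level 40, left associativity, only parsing) : cat_scope.
Notation "⌈ f ⌉" := (castm f ltac:(strictness) ltac:(strictness))
  (at level 0, f at level 200, only parsing) : cat_scope.

Record is_strict_monoidal (C D : strict_monoidal_category) (F : C -> D)
    (Fm : forall X Y : C, hom X Y -> hom (F X) (F Y)) : Prop := IsStrictMonoidal {
  Fm_id : forall X, Fm X X (idm X) = idm (F X);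
  Fm_comp : forall (X Y Z : C) (g : hom Y Z) (f : hom X Y),
    Fm X Z (g ∘ f) = Fm Y Z g ∘ Fm X Y f;
  F_unit : F unit_ob = unit_ob;
  F_tens : forall X Y, F (X ⊗ Y) = F X ⊗ F Y;
  Fm_tens : forall (X X' Y Y' : C) (f : hom X X') (g : hom Y Y'),
    Fm (X ⊗ Y) (X' ⊗ Y') (f ⊠ g) ≡ Fm X X' f ⊠ Fm Y Y' g
}.

Record strict_monoidal_functor (C D : strict_monoidal_category) : Type :=
  StrictMonoidalFunctor {
    fob :> C -> D;
    fmor : forall X Y : C, hom X Y -> hom (fob X) (fob Y);
    fmor_strict : is_strict_monoidal fmor
  }.
Arguments fmor {C D} s {X Y} _.

(* C^{op, ⊗-op} *)
Section OppositeReversed.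
Variable C : strict_monoidal_category.

Definition op_cat : category := {|
  ob := C;
  hom := fun X Y => @hom C Y X;
  idm := @idm C;
  comp := fun X Y Z g f => f ∘ g;
  comp1m := fun X Y f => compm1 f;
  compm1 := fun X Y f => comp1m f;
  compA := fun X Y Z W h g f => esym (compA f g h)
|}.

Lemma same_arrow_op (X Y X' Y' : C) (f : @hom C X Y) (g : @hom C X' Y') :
  f ≡ g -> @same_arrow op_cat Y X f Y' X' g.
Proof. by case. Qed.

Lemma same_arrow_sym (X Y X' Y' : C) (f : @hom C X Y) (g : @hom C X' Y') :
  f ≡ g -> g ≡ f.
Proof. by case. Qed.

Definition op_rev : strict_monoidal_category := {|
  smc_cat := op_cat;
  unit_ob := @unit_ob C;
  tens := fun X Y => Y ⊗ X;
  tensm := fun X X' Y Y' f g => g ⊠ f;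
  tensm_id := fun X Y => tensm_id Y X;
  tensm_comp := fun X X' X'' Y Y' Y'' f f' g g' => tensm_comp g' g f' f;
  tensA := fun X Y Z => esym (tensA Z Y X);
  tens1o := @tenso1 C;
  tenso1 := @tens1o C;
  tensmA := fun X X' Y Y' Z Z' f g h =>
    same_arrow_op (same_arrow_sym (tensmA h g f));
  tensm1m := fun X Y f => same_arrow_op (tensmm1 f);
  tensmm1 := fun X Y f => same_arrow_op (tensm1m f)
|}.

End OppositeReversed.

Record rigid (C : strict_monoidal_category) : Type := Rigid {
  ldual : C -> C;
  evl : forall X, hom (ldual X ⊗ X) unit_ob;
  coevl : forall X, hom unit_ob (X ⊗ ldual X);
  snakel : forall X, (idm X ⊠ evl X) ⊚ (coevl X ⊠ idm X) ≡ idm X;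
  snakel_dual : forall X,
    (evl X ⊠ idm (ldual X)) ⊚ (idm (ldual X) ⊠ coevl X) ≡ idm (ldual X);
  rdual : C -> C;
  evr : forall X, hom (X ⊗ rdual X) unit_ob;
  coevr : forall X, hom unit_ob (rdual X ⊗ X);
  snaker : forall X, (evr X ⊠ idm X) ⊚ (idm X ⊠ coevr X) ≡ idm X;
  snaker_dual : forall X,
    (idm (rdual X) ⊠ evr X) ⊚ (coevr X ⊠ idm (rdual X)) ≡ idm (rdual X)
}.

Section StrictRigid.
Variables (C : strict_monoidal_category) (D : rigid C).

Definition ldualm (X Y : C) (f : hom X Y) : hom (ldual D Y) (ldual D X) :=
  ⌈ (evl D Y ⊠ idm (ldual D X))
    ⊚ (idm (ldual D Y) ⊠ f ⊠ idm (ldual D X))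
    ⊚ (idm (ldual D Y) ⊠ coevl D X) ⌉.

Definition rdualm (X Y : C) (f : hom X Y) : hom (rdual D Y) (rdual D X) :=
  ⌈ (idm (rdual D X) ⊠ evr D Y)
    ⊚ (idm (rdual D X) ⊠ f ⊠ idm (rdual D Y))
    ⊚ (coevr D X ⊠ idm (rdual D Y)) ⌉.

Record strict_rigid : Prop := StrictRigid {
  ldual_strict : @is_strict_monoidal C (op_rev C) (ldual D) ldualm;
  rdual_strict : @is_strict_monoidal C (op_rev C) (rdual D) rdualm;
  rldual : forall X, rdual D (ldual D X) = X;
  lrdual : forall X, ldual D (rdual D X) = X;
  rldualm : forall (X Y : C) (f : hom X Y), rdualm (ldualm f) ≡ f;
  lrdualm : forall (X Y : C) (f : hom X Y), ldualm (rdualm f) ≡ f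
}.

End StrictRigid.

Section TwistedCentre.
Variables (C : strict_monoidal_category) (R : strict_monoidal_functor C C).

Record half_braiding (A : C) : Type := HalfBraiding {
  hb : forall Y : C, hom (A ⊗ R Y) (Y ⊗ A);
  hb_inv : forall Y : C, hom (Y ⊗ A) (A ⊗ R Y);
  hb_iso : forall Y, is_inverse (hb Y) (hb_inv Y);
  hb_nat : forall (Y Y' : C) (f : hom Y Y'),
    hb Y' ∘ (idm A ⊠ fmor R f) = (f ⊠ idm A) ∘ hb Y;
  hb_tens : forall Y W : C,
    hb (Y ⊗ W) ≡ (idm Y ⊠ hb W) ⊚ (hb Y ⊠ idm (R W))
}.

Record zobj : Type := ZObj { zcarrier : C; zhb : half_braiding zcarrier }.

Definition is_zmor (a b : zobj) (f : hom (zcarrier a) (zcarrier b)) : Prop :=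
  forall Y : C, (idm Y ⊠ f) ∘ hb (zhb a) Y = hb (zhb b) Y ∘ (f ⊠ idm (R Y)).

Definition zhom (a b : zobj) : Type :=
  {f : hom (zcarrier a) (zcarrier b) | is_zmor f}.

Lemma zmor_id (a : zobj) : @is_zmor a a (idm (zcarrier a)).
Proof. by move=> Y; rewrite !tensm_id comp1m compm1. Qed.

Lemma zmor_comp (a b c : zobj) (g : zhom b c) (f : zhom a b) :
  is_zmor (sval g ∘ sval f).
Proof.
case: g f => [g hg] [f hf] Y /=.
by rewrite -(comp1m (idm Y)) -(comp1m (idm (R Y))) !tensm_comp -compA hf compA hg compA.
Qed.

Lemma zhom_eq (a b : zobj) (f g : zhom a b) : sval f = sval g -> f = g.
Proof.
case: f g => [f hf] [g hg] /= e; case: _ / e hg => hg.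
by rewrite (proof_irrelevance _ hf hg).
Qed.
Arguments zhom_eq {a b f g} & _.

Definition twisted_centre : category := {|
  ob := zobj;
  hom := zhom;
  idm := fun a => exist _ _ (zmor_id a);
  comp := fun a b c g f => exist _ _ (zmor_comp g f);
  comp1m := fun a b f => zhom_eq (comp1m (sval f));
  compm1 := fun a b f => zhom_eq (compm1 (sval f));
  compA := fun a b c d h g f => zhom_eq (compA (sval h) (sval g) (sval f))
|}.

End TwistedCentre.

Section Picard.
Variables (C : strict_monoidal_category) (D : rigid C).
Variable R : strict_monoidal_functor C C.
Notation Z := (twisted_centre R).

Definition C_invertible (a : Z) : Prop :=
  is_iso (evl D (zcarrier a)) /\ is_iso (coevl D (zcarrier a)).

Definition dual_hb (a : Z) (Y : C) :
    let A := zcarrier a in hom (ldual D A ⊗ Y) (R Y ⊗ ldual D A) :=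
  let A := zcarrier a in
  ⌈ (evl D A ⊠ idm (R Y ⊗ ldual D A))
    ⊚ (idm (ldual D A) ⊠ hb_inv (zhb a) Y ⊠ idm (ldual D A))
    ⊚ (idm (ldual D A ⊗ Y) ⊠ coevl D A) ⌉.

Definition heap_carrier (a b c : Z) : C :=
  zcarrier a ⊗ ldual D (zcarrier b) ⊗ zcarrier c.

Definition heap_hb (a b c : Z) (Y : C) :
    hom (heap_carrier a b c ⊗ R Y) (Y ⊗ heap_carrier a b c) :=
  let A := zcarrier a in let B' := ldual D (zcarrier b) in let G := zcarrier c in
  ⌈ (hb (zhb a) Y ⊠ idm B' ⊠ idm G)
    ⊚ (idm A ⊠ dual_hb b Y ⊠ idm G)
    ⊚ (idm A ⊠ idm B' ⊠ hb (zhb c) Y) ⌉.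

(* d is the object α ⊗ β^∨ ⊗ γ of the twisted centre; it is unique, since the
   inverse of a half-braiding is determined by the half-braiding. *)
Definition is_heap_product (a b c d : Z) : Prop :=
  exists s : half_braiding R (heap_carrier a b c),
    (forall Y, hb s Y = heap_hb a b c Y) /\ d = ZObj s.

Definition iso_class (a : Z) : Z -> Prop := fun b => isomorphic a b.

Definition Pic : Type :=
  {S : Z -> Prop | exists a, C_invertible a /\ S = iso_class a}.

Definition pic_class (a : Z) (ha : C_invertible a) : Pic :=
  exist _ (iso_class a) (ex_intro _ a (conj ha erefl)).

End Picard.

Definition is_heap (G : Type) (op : G -> G -> G -> G) : Prop :=
  (forall g h i j k, op g h (op i j k) = op (op g h i) j k)
  /\ (forall g h, op g g h = h /\ op h g g = h).

(* Main.v *)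
(* An arrow f is replaced by its whiskerings f ⊗ id_W for all W, retyped between
   right-nested objects A ⊗ (B ⊗ W).  Evaluations, coevaluations and
   half-braidings then become families natural in W, and string-diagram
   computations are plain equations without casts; W = 1 gives back f.

   The tensor inverse of an object need not satisfy the snake identities, but its
   existence makes X ⊗ - faithful and forces ev and coev of X to be
   isomorphisms; hence C-invertibility passes to duals and tensor products.
   The half-braiding of β^∨ is compatible with ev and coev of β, so that
   α ⊗ ev and coev ⊗ γ are isomorphisms α ⊗ β^∨ ⊗ β ≅ α and
   γ ≅ α ⊗ α^∨ ⊗ γ of the centre, and strictness makes the two sides of the
   associativity law the same object.  The product is well defined on classes
   because the dual of an isomorphism of the centre is again compatible with the
   half-braidings. *)
From mathcomp Require Import ssreflect ssrfun.
From Stdlib Require Import ProofIrrelevance FunctionalExtensionality.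
From Stdlib Require Import PropExtensionality IndefiniteDescription.
Require Import Defs.

Set Implicit Arguments.
Unset Strict Implicit.
Unset Printing Implicit Defensive.
Local Open Scope cat_scope.

(** * Equality of arrows up to strictness *)

Section SameArrow.
Variable C : category.

Lemma same_castE (X Y X' Y' : C) (f : hom X Y) (g : hom X' Y') :
  f ≡ g -> exists (eX : X = X') (eY : Y = Y'), castm f eX eY = g.
Proof. by case; exists erefl, erefl. Qed.

(** By proof irrelevance an equality [X = X] is reflexivity, so the casts vanish. This is the way
    back from [≡] to plain equality of parallel arrows. *)
Lemma same_eq (X Y : C) (f g : hom X Y) : f ≡ g -> f = g.
Proof.
move=> /same_castE [eX [eY]].
by rewrite (proof_irrelevance _ eX erefl) (proof_irrelevance _ eY erefl).
Qed.

Lemma same_refl (X Y : C) (f : hom X Y) : f ≡ f.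
Proof. by []. Qed.

Lemma same_sym (X Y X' Y' : C) (f : hom X Y) (g : hom X' Y') : f ≡ g -> g ≡ f.
Proof. by case. Qed.

Lemma same_trans (X Y X' Y' X'' Y'' : C) (f : hom X Y) (g : hom X' Y')
    (h : hom X'' Y'') : f ≡ g -> g ≡ h -> f ≡ h.
Proof. by case. Qed.

Lemma same_castm (X Y X' Y' : C) (f : hom X Y) (eX : X = X') (eY : Y = Y') :
  castm f eX eY ≡ f.
Proof. by case: _ / eX; case: _ / eY. Qed.

Lemma same_idm (X X' : C) : X = X' -> idm X ≡ idm X'.
Proof. by move=> ->. Qed.

(** The middle objects are identified twice, once through [g] and once through [f]; proof
    irrelevance merges the two identifications. *)
Lemma same_comp (X Y Z X' Y' Z' : C) (g : hom Y Z) (f : hom X Y)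
    (g' : hom Y' Z') (f' : hom X' Y') :
  g ≡ g' -> f ≡ f' -> g ∘ f ≡ g' ∘ f'.
Proof.
move=> /same_castE [eY [eZ <-]] /same_castE [eX [eY' <-]].
case: _ / eX eY' => eY'; case: _ / eY eY' => eY'; case: _ / eZ.
by rewrite (proof_irrelevance _ eY' erefl).
Qed.

Lemma same_iso (X Y X' Y' : C) (f : hom X Y) (g : hom X' Y') :
  f ≡ g -> is_iso f -> is_iso g.
Proof. by case. Qed.

Lemma iso_idm (X : C) : is_iso (idm X).
Proof. by exists (idm X); rewrite /is_inverse comp1m. Qed.

Lemma iso_comp (X Y Z : C) (g : hom Y Z) (f : hom X Y) :
  is_iso g -> is_iso f -> is_iso (g ∘ f).
Proof.
case=> g' [g'g gg'] [f' [f'f ff']]; exists (f' ∘ g'); split.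
  by rewrite compA -(compA f') g'g compm1.
by rewrite compA -(compA g) ff' compm1.
Qed.

Lemma iso_inverse (X Y : C) (f : hom X Y) (g : hom Y X) :
  is_inverse f g -> is_iso g.
Proof. by case=> gf fg; exists f. Qed.

Lemma iso_monic (X Y Z : C) (f : hom Y Z) (g h : hom X Y) :
  is_iso f -> f ∘ g = f ∘ h -> g = h.
Proof.
by case=> f' [f'f _] e; rewrite -[g]comp1m -[h]comp1m -f'f -!compA e.
Qed.

Lemma iso_epic (X Y Z : C) (f : hom X Y) (g h : hom Y Z) :
  is_iso f -> g ∘ f = h ∘ f -> g = h.
Proof.
by case=> f' [_ ff'] e; rewrite -[g]compm1 -[h]compm1 -ff' !compA e.
Qed.

Lemma iso_castm (X Y X' Y' : C) (f : hom X Y) (eX : X = X') (eY : Y = Y') :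
  is_iso f -> is_iso (castm f eX eY).
Proof. exact/same_iso/same_sym/same_castm. Qed.

Lemma iso_comp_cast (X Y Y' Z : C) (g : hom Y' Z) (f : hom X Y) (e : Y = Y') :
  is_iso g -> is_iso f -> is_iso (comp_cast g f e).
Proof. by move=> ig jf; apply: iso_comp => //; apply: iso_castm. Qed.

Lemma isomorphic_refl (X : C) : isomorphic X X.
Proof. by exists (idm X); apply: iso_idm. Qed.

Lemma isomorphic_sym (X Y : C) : isomorphic X Y -> isomorphic Y X.
Proof. by case=> f [g [gf fg]]; exists g, f. Qed.

Lemma isomorphic_trans (X Y Z : C) :
  isomorphic X Y -> isomorphic Y Z -> isomorphic X Z.
Proof. by case=> f jf [g ig]; exists (g ∘ f); apply: iso_comp. Qed.

End SameArrow.

(** * Whiskering with a free object *)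

Section Lifting.
Variable C : strict_monoidal_category.
Implicit Types X Y Z W : C.

Lemma whD X Y Z W (g : hom Y Z) (f : hom X Y) :
  idm W ⊠ (g ∘ f) = (idm W ⊠ g) ∘ (idm W ⊠ f).
Proof. by rewrite -tensm_comp comp1m. Qed.

Lemma whDr X Y Z W (g : hom Y Z) (f : hom X Y) :
  (g ∘ f) ⊠ idm W = (g ⊠ idm W) ∘ (f ⊠ idm W).
Proof. by rewrite -tensm_comp comp1m. Qed.

Lemma interchange X X' Y Y' (f : hom X X') (g : hom Y Y') :
  (f ⊠ idm Y') ∘ (idm X ⊠ g) = (idm X' ⊠ g) ∘ (f ⊠ idm Y).
Proof. by rewrite -!tensm_comp !comp1m !compm1. Qed.

Lemma iso_tensm X X' Y Y' (f : hom X X') (g : hom Y Y') :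
  is_iso f -> is_iso g -> is_iso (f ⊠ g).
Proof.
case=> f' [f'f ff'] [g' [g'g gg']]; exists (f' ⊠ g').
by rewrite /is_inverse -!tensm_comp f'f ff' g'g gg' !tensm_id.
Qed.

Lemma isomorphic_tens X X' Y Y' :
  isomorphic X X' -> isomorphic Y Y' -> isomorphic (X ⊗ Y) (X' ⊗ Y').
Proof. by case=> f jf [g ig]; exists (f ⊠ g); apply: iso_tensm. Qed.

Lemma same_tensm X X' Y Y' X1 X1' Y1 Y1' (f : hom X X') (g : hom Y Y')
    (f1 : hom X1 X1') (g1 : hom Y1 Y1') :
  f ≡ f1 -> g ≡ g1 -> f ⊠ g ≡ f1 ⊠ g1.
Proof. by case; case. Qed.

(* In the lemmas [lift_*], the arrow [F] stands for [f ⊠ idm W] retyped between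
   right-nested objects, so that [F] can be computed along the syntax of [f]. *)
Lemma lift_refl X Y W (f : hom X Y) : f ⊠ idm W ≡ f ⊠ idm W.
Proof. by []. Qed.

Lemma lift_comp X Y Z W X' Y' Z' (g : hom Y Z) (f : hom X Y)
    (G : hom Y' Z') (F : hom X' Y') :
  g ⊠ idm W ≡ G -> f ⊠ idm W ≡ F -> (g ∘ f) ⊠ idm W ≡ G ∘ F.
Proof. by rewrite whDr; apply: same_comp. Qed.

Lemma lift_castm X Y X1 Y1 W X' Y' (f : hom X Y) (eX : X = X1) (eY : Y = Y1)
    (F : hom X' Y') :
  f ⊠ idm W ≡ F -> castm f eX eY ⊠ idm W ≡ F.
Proof. by case: _ / eX; case: _ / eY. Qed.

Lemma lift_comp_cast X Y Y1 Z W X' Y' Z' (g : hom Y1 Z) (f : hom X Y)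
    (e : Y = Y1) (G : hom Y' Z') (F : hom X' Y') :
  g ⊠ idm W ≡ G -> f ⊠ idm W ≡ F -> comp_cast g f e ⊠ idm W ≡ G ∘ F.
Proof. by move=> gG fF; apply: lift_comp => //; apply: lift_castm. Qed.

Lemma lift_idl X Y Z W X' Y' (f : hom X Y) (F : hom X' Y') :
  f ⊠ idm W ≡ F -> (idm Z ⊠ f) ⊠ idm W ≡ idm Z ⊠ F.
Proof.
move=> fF; apply: same_trans (same_sym (tensmA _ _ _)) _.
exact: same_tensm.
Qed.

Lemma lift_idl2 X Y Z1 Z2 W X' Y' (f : hom X Y) (F : hom X' Y') :
  f ⊠ idm W ≡ F ->
  (idm (Z1 ⊗ Z2) ⊠ f) ⊠ idm W ≡ idm Z1 ⊠ (idm Z2 ⊠ F).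
Proof.
move=> fF; apply: same_trans (lift_idl _ fF) _.
by rewrite -tensm_id; apply: same_sym (tensmA _ _ _).
Qed.

(** Whiskering on the right twice is whiskering once by the product. [V] is kept apart from [Z ⊗ W]
    so that the free strand can be bracketed to the right. *)
Lemma lift_idr X Y Z W V X' Y' (f : hom X Y) (F : hom X' Y') :
  f ⊠ idm V ≡ F -> V = Z ⊗ W -> (f ⊠ idm Z) ⊠ idm W ≡ F.
Proof.
move=> fF eV; apply: same_trans (same_sym (tensmA _ _ _)) _.
by rewrite tensm_id -eV.
Qed.

Lemma same_lift X Y X1 Y1 X' Y' (f : hom X Y) (g : hom X1 Y1) (F : hom X' Y') :
  f ⊠ idm unit_ob ≡ F -> g ⊠ idm unit_ob ≡ F -> f ≡ g.
Proof.
move=> fF gF; apply: same_trans (same_sym (tensmm1 f)) _.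
exact: same_trans fF (same_trans (same_sym gF) (tensmm1 g)).
Qed.

Lemma eq_lift X Y X' Y' X1 Y1 (f g : hom X Y) (F : hom X' Y') (G : hom X1 Y1) :
  f ⊠ idm unit_ob ≡ F -> g ⊠ idm unit_ob ≡ G -> F ≡ G -> f = g.
Proof.
move=> fF gG FG; apply: same_eq; apply: (same_lift fF).
exact: same_trans gG (same_sym FG).
Qed.

(** The digits count the tensor factors of source and target apart from the free strand [W]:
    [lift22] serves half-braidings, [lift20] evaluations and [lift02] coevaluations. *)
Definition lift22 X1 X2 Y1 Y2 (f : hom (X1 ⊗ X2) (Y1 ⊗ Y2)) W :
    hom (X1 ⊗ (X2 ⊗ W)) (Y1 ⊗ (Y2 ⊗ W)) :=
  castm (f ⊠ idm W) (esym (tensA _ _ _)) (esym (tensA _ _ _)).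

Definition lift20 X1 X2 (f : hom (X1 ⊗ X2) unit_ob) W : hom (X1 ⊗ (X2 ⊗ W)) W :=
  castm (f ⊠ idm W) (esym (tensA _ _ _)) (tens1o _).

Definition lift02 Y1 Y2 (f : hom unit_ob (Y1 ⊗ Y2)) W : hom W (Y1 ⊗ (Y2 ⊗ W)) :=
  castm (f ⊠ idm W) (tens1o _) (esym (tensA _ _ _)).

Lemma lift22E X1 X2 Y1 Y2 (f : hom (X1 ⊗ X2) (Y1 ⊗ Y2)) W :
  f ⊠ idm W ≡ lift22 f W.
Proof. exact/same_sym/same_castm. Qed.

Lemma lift20E X1 X2 (f : hom (X1 ⊗ X2) unit_ob) W : f ⊠ idm W ≡ lift20 f W.
Proof. exact/same_sym/same_castm. Qed.

Lemma lift02E Y1 Y2 (f : hom unit_ob (Y1 ⊗ Y2)) W : f ⊠ idm W ≡ lift02 f W.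
Proof. exact/same_sym/same_castm. Qed.

Lemma same_wh2 X1 X2 W W' (g : hom W W') :
  idm (X1 ⊗ X2) ⊠ g ≡ idm X1 ⊠ (idm X2 ⊠ g).
Proof. by rewrite -tensm_id; apply: same_sym (tensmA _ _ _). Qed.

(** Naturality in the free strand is the interchange law seen through the casts; the same holds for
    the two lemmas that follow. *)
Lemma lift22_nat X1 X2 Y1 Y2 (f : hom (X1 ⊗ X2) (Y1 ⊗ Y2)) W W' (g : hom W W') :
  lift22 f W' ∘ (idm X1 ⊠ (idm X2 ⊠ g)) = (idm Y1 ⊠ (idm Y2 ⊠ g)) ∘ lift22 f W.
Proof.
apply: same_eq.
apply: same_trans (same_comp (same_castm _ _ _) (same_sym (same_wh2 _ _ _))) _.
rewrite interchange.
exact: same_comp (same_wh2 _ _ _) (lift22E _ _).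
Qed.

Lemma lift20_nat X1 X2 (f : hom (X1 ⊗ X2) unit_ob) W W' (g : hom W W') :
  lift20 f W' ∘ (idm X1 ⊠ (idm X2 ⊠ g)) = g ∘ lift20 f W.
Proof.
apply: same_eq.
apply: same_trans (same_comp (same_castm _ _ _) (same_sym (same_wh2 _ _ _))) _.
rewrite interchange.
exact: same_comp (tensm1m _) (lift20E _ _).
Qed.

Lemma lift02_nat Y1 Y2 (f : hom unit_ob (Y1 ⊗ Y2)) W W' (g : hom W W') :
  lift02 f W' ∘ g = (idm Y1 ⊠ (idm Y2 ⊠ g)) ∘ lift02 f W.
Proof.
apply: same_eq.
apply: same_trans (same_comp (same_castm _ _ _) (same_sym (tensm1m _))) _.
rewrite interchange.
exact: same_comp (same_wh2 _ _ _) (lift02E _ _).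
Qed.

Lemma iso_lift20 X1 X2 (f : hom (X1 ⊗ X2) unit_ob) W :
  is_iso f -> is_iso (lift20 f W).
Proof. by move=> jf; apply/iso_castm/iso_tensm => //; apply: iso_idm. Qed.

Lemma lift22K X1 X2 Y1 Y2 (f : hom (X1 ⊗ X2) (Y1 ⊗ Y2))
    (g : hom (Y1 ⊗ Y2) (X1 ⊗ X2)) W :
  g ∘ f = idm _ -> lift22 g W ∘ lift22 f W = idm _.
Proof.
move=> gf; apply: same_eq.
apply: same_trans (same_comp (same_castm _ _ _) (same_castm _ _ _)) _.
by rewrite -whDr gf tensm_id; apply/same_idm/esym/tensA.
Qed.

End Lifting.

(** * Duals and invertible objects *)

Section Rigid.
Variables (C : strict_monoidal_category) (D : rigid C).
Implicit Types X Y Z W V : C.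

Notation "X ^∨" := (ldual D X) (at level 1, format "X ^∨").
Notation evW X W := (lift20 (evl D X) W).
Notation coevW X W := (lift02 (coevl D X) W).

Lemma snakeW X W : (idm X ⊠ evW X W) ∘ coevW X (X ⊗ W) = idm (X ⊗ W).
Proof.
apply: same_eq; apply: same_trans (_ : idm X ⊠ idm W ≡ _); last by rewrite tensm_id.
apply: same_trans (same_tensm (snakel D X) (same_refl (idm W))).
apply: same_sym; apply: lift_comp_cast; first exact/lift_idl/lift20E.
by apply: lift_idr (lift02E _ _) _.
Qed.

Lemma snake_dualW X W : evW X (X^∨ ⊗ W) ∘ (idm X^∨ ⊠ coevW X W) = idm (X^∨ ⊗ W).
Proof.
apply: same_eq; apply: same_trans (_ : idm X^∨ ⊠ idm W ≡ _); last by rewrite tensm_id.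
apply: same_trans (same_tensm (snakel_dual D X) (same_refl (idm W))).
apply: same_sym; apply: lift_comp_cast; last exact/lift_idl/lift02E.
by apply: lift_idr (lift20E _ _) _.
Qed.

Lemma ldualmW X Y W (f : hom X Y) :
  ldualm D f ⊠ idm W =
  evW Y (X^∨ ⊗ W) ∘ (idm Y^∨ ⊠ (f ⊠ idm (X^∨ ⊗ W))) ∘ (idm Y^∨ ⊠ coevW X W).
Proof.
apply: same_eq; apply: lift_castm; apply: lift_comp_cast; last exact/lift_idl/lift02E.
apply: lift_comp_cast; first by apply: lift_idr (lift20E _ _) _.
by apply: lift_idr (lift_idl _ (lift_refl _ _)) _.
Qed.

(** Dinaturality of evaluation: one snake straightens the bend in the definition of the dual
    arrow. *)
Lemma ev_ldualm X Y W (f : hom X Y) :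
  evW X W ∘ (ldualm D f ⊠ idm (X ⊗ W)) = evW Y W ∘ (idm Y^∨ ⊠ (f ⊠ idm W)).
Proof.
rewrite ldualmW !compA -lift20_nat -!compA; congr (_ ∘ _).
by rewrite !compA -!whD -interchange -compA snakeW compm1.
Qed.

Lemma coev_ldualm X Y W (f : hom X Y) :
  (idm Y ⊠ (ldualm D f ⊠ idm W)) ∘ coevW Y W = (f ⊠ idm (X^∨ ⊗ W)) ∘ coevW X W.
Proof.
rewrite ldualmW !whD -!compA -lift02_nat.
by rewrite (compA _ (coevW Y _)) -lift02_nat !compA snakeW comp1m.
Qed.

(** No chosen dual occurs here and the two isomorphisms need not be compatible, so closure under
    tensor products is immediate. *)
Definition invertible_ob X : Prop :=
  exists Y, isomorphic (Y ⊗ X) unit_ob /\ isomorphic (X ⊗ Y) unit_ob.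

Lemma invertible_tens X Y :
  invertible_ob X -> invertible_ob Y -> invertible_ob (X ⊗ Y).
Proof.
case=> X' [X'X XX'] [Y' [Y'Y YY']]; exists (Y' ⊗ X'); split.
  apply: isomorphic_trans Y'Y; rewrite tensA -(tensA Y').
  apply: isomorphic_tens; last exact: isomorphic_refl.
  rewrite -[X in isomorphic _ X]tenso1.
  by apply: isomorphic_tens => //; apply: isomorphic_refl.
apply: isomorphic_trans XX'; rewrite tensA -(tensA X).
apply: isomorphic_tens; last exact: isomorphic_refl.
rewrite -[Z in isomorphic _ Z]tenso1.
by apply: isomorphic_tens => //; apply: isomorphic_refl.
Qed.

(** Whiskering further by [X'] and contracting [X' ⊗ X] by the natural isomorphism [lift20 e]
    recovers an arrow from its whiskering by [X]. *)
Lemma wh_faithful X X' Y Z (f g : hom Y Z) :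
  isomorphic (X' ⊗ X) unit_ob -> idm X ⊠ f = idm X ⊠ g -> f = g.
Proof.
case=> e je fg; apply: (iso_epic (f := lift20 e Y)); first exact: iso_lift20.
by rewrite -!lift20_nat fg.
Qed.

Lemma iso_of_lift X Y (f : hom X Y) : is_iso (f ⊠ idm unit_ob) -> is_iso f.
Proof. exact/same_iso/tensmm1. Qed.

(* The inverse of [ev] is [coev] transported along [Y ⊗ X ≅ 1]; whiskering it
   by [X] gives back [coev], so the second snake identity makes it two-sided. *)
Lemma invertible_ev_iso X : invertible_ob X -> is_iso (evl D X).
Proof.
case=> Y [[e je] XY]; apply: iso_of_lift; set W := unit_ob.
suff: is_iso (evW X W) by apply/same_iso/same_castm.
have jeW V : is_iso (lift20 e V) by apply: iso_lift20.
have [i [ie ei]] := jeW W.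
pose s := lift20 e (X^∨ ⊗ (X ⊗ W)) ∘ (idm Y ⊠ coevW X (X ⊗ W)) ∘ i.
have Xs : idm X ⊠ s = coevW X (X ⊗ W).
  (* Since [X ⊗ Y ≅ 1], whiskering by [Y] is faithful; after it [lift20 e] can be cancelled on the
     left. *)
  apply: wh_faithful XY _; apply: (iso_monic (jeW _)).
  by rewrite lift20_nat /s -!compA ie compm1.
exists s; split.
  by rewrite -lift20_nat Xs snake_dualW.
by rewrite /s !compA -lift20_nat -(compA (lift20 e W)) -whD snakeW tensm_id compm1.
Qed.

(** As [ev] is invertible, the snake identity makes [coev] an isomorphism at free strands of the
    form [X ⊗ W]. Any [W] is isomorphic to [X ⊗ (Y ⊗ W)], and naturality carries the result over. *)
Lemma invertible_coev_iso X : invertible_ob X -> is_iso (coevl D X).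
Proof.
move=> iX; have jev := invertible_ev_iso iX.
have jX W : is_iso (coevW X (X ⊗ W)).
  have [|j [ji ij]] := @iso_tensm _ _ _ _ _ (idm X) (evW X W) (iso_idm _).
    exact: iso_lift20.
  exists (idm X ⊠ evW X W); split; first exact: snakeW.
  apply: (@iso_monic _ _ _ _ (idm X ⊠ evW X W)); first by exists j.
  by rewrite compA snakeW comp1m compm1.
have [Y [_ [c jc]]] := iX; apply: iso_of_lift; set W := unit_ob.
suff: is_iso (coevW X W) by apply/same_iso/same_castm.
have [c' [c'c cc']] : is_iso (lift20 c W) by apply: iso_lift20.
have -> : coevW X W =
    (idm X ⊠ (idm X^∨ ⊠ lift20 c W)) ∘ coevW X (X ⊗ (Y ⊗ W)) ∘ c'.
  by rewrite -lift02_nat -compA cc' compm1.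
apply: iso_comp; last exact: iso_inverse (conj c'c cc').
apply: iso_comp => //; do 2!(apply: iso_tensm; first exact: iso_idm).
exact: iso_lift20.
Qed.

(** Strict rigidity makes left dualising a functor to the opposite category, and functors preserve
    inverses. *)
Lemma ldualm_iso X Y (f : hom X Y) : strict_rigid D -> is_iso f -> is_iso (ldualm D f).
Proof.
case=> sD _ _ _ _ _ [g [gf fg]]; exists (ldualm D g).
have dual_comp U V T := @Fm_comp _ _ _ _ sD U V T.
have dual_id U := @Fm_id _ _ _ _ sD U.
by split; rewrite -[LHS]dual_comp /= (gf, fg) [LHS]dual_id.
Qed.

End Rigid.

(** * The twisted centre *)

Section Centre.
Variables (C : strict_monoidal_category) (D : rigid C).
Variable R : strict_monoidal_functor C C.
Notation Z := (twisted_centre R).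
Implicit Types (Y V W : C) (a b c : Z).

Notation "X ^∨" := (ldual D X) (at level 1, format "X ^∨").
Notation evW X W := (lift20 (evl D X) W).
Notation coevW X W := (lift02 (coevl D X) W).
Notation hbW a Y W := (lift22 (hb (zhb a) Y) W).
Notation hiW a Y W := (lift22 (hb_inv (zhb a) Y) W).
Notation dhW a Y W := (lift22 (dual_hb D a Y) W).
Local Notation "'ca' a" := (zcarrier a) (at level 1, a at level 1).

(** This lemma and the next three let an equation of composites be rewritten inside a
    right-associated chain or under whiskering. *)
Lemma comp_eq (X X1 X2 X3 : C) (g : hom X1 X3) (f : hom X X1) (k : hom X2 X3)
    (h : hom X X2) (e : g ∘ f = k ∘ h) X0 (x : hom X0 X) :
  g ∘ (f ∘ x) = k ∘ (h ∘ x).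
Proof. by rewrite !compA e. Qed.

Lemma comp_eq1 (X X1 : C) (g : hom X1 X) (f : hom X X1) (e : g ∘ f = idm X)
    X0 (x : hom X0 X) :
  g ∘ (f ∘ x) = x.
Proof. by rewrite compA e comp1m. Qed.

Lemma wh_eq U (X X1 X2 X3 : C) (g : hom X1 X3) (f : hom X X1) (k : hom X2 X3)
    (h : hom X X2) (e : g ∘ f = k ∘ h) :
  (idm U ⊠ g) ∘ (idm U ⊠ f) = (idm U ⊠ k) ∘ (idm U ⊠ h).
Proof. by rewrite -!whD e. Qed.

Lemma wh_eq1 U (X X1 : C) (g : hom X1 X) (f : hom X X1) (e : g ∘ f = idm X) :
  (idm U ⊠ g) ∘ (idm U ⊠ f) = idm (U ⊗ X).
Proof. by rewrite -!whD e tensm_id. Qed.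

Lemma same_lift20 (X1 X2 : C) (f : hom (X1 ⊗ X2) unit_ob) W W' :
  W = W' -> lift20 f W ≡ lift20 f W'.
Proof. by move=> ->. Qed.

Lemma same_lift22 (X1 X2 Y1 Y2 : C) (f : hom (X1 ⊗ X2) (Y1 ⊗ Y2)) W W' :
  W = W' -> lift22 f W ≡ lift22 f W'.
Proof. by move=> ->. Qed.

Lemma same_inverse (X Y X' Y' : C) (f : hom X Y) (g : hom Y X) (f' : hom X' Y')
    (g' : hom Y' X') :
  g ∘ f = idm X -> f' ∘ g' = idm Y' -> f ≡ f' -> g ≡ g'.
Proof.
move=> gf fg' ff'; case: _ _ _ / ff' g' fg' => g' fg'.
by rewrite -[g]compm1 -fg' compA gf comp1m.
Qed.

(** * Half-braidings with a free strand *)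

Lemma R_tens Y V : R (Y ⊗ V) = R Y ⊗ R V.
Proof. exact: (F_tens (fmor_strict R)). Qed.

Lemma hbK a Y W : hiW a Y W ∘ hbW a Y W = idm _.
Proof. by apply: lift22K; case: (hb_iso (zhb a) Y). Qed.

Lemma hiK a Y W : hbW a Y W ∘ hiW a Y W = idm _.
Proof. by apply: lift22K; case: (hb_iso (zhb a) Y). Qed.

Lemma hbW_nat a Y Y' W (f : hom Y Y') :
  hbW a Y' W ∘ (idm (ca a) ⊠ (fmor R f ⊠ idm W)) =
  (f ⊠ idm (ca a ⊗ W)) ∘ hbW a Y W.
Proof.
apply: same_eq; apply: same_trans (_ : (hb (zhb a) Y' ∘ (idm (ca a) ⊠ fmor R f)) ⊠ idm W ≡ _).
  by apply/same_sym/lift_comp; [apply: lift22E | apply: lift_idl].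
rewrite hb_nat; apply: lift_comp; last exact: lift22E.
by apply: lift_idr (lift_refl _ _) _.
Qed.

Lemma hiW_nat a Y Y' W (f : hom Y Y') :
  hiW a Y' W ∘ (f ⊠ idm (ca a ⊗ W)) =
  (idm (ca a) ⊠ (fmor R f ⊠ idm W)) ∘ hiW a Y W.
Proof.
rewrite -[LHS]compm1 -(hiK a Y W) -[LHS]compA (comp_eq (esym (hbW_nat _ _ _))).
by rewrite compA hbK comp1m.
Qed.

Lemma hbW_tens a Y V W :
  hbW a (Y ⊗ V) W ≡ (idm Y ⊠ hbW a V W) ∘ hbW a Y (R V ⊗ W).
Proof.
apply: same_trans (same_castm _ _ _) _.
apply: same_trans (same_tensm (hb_tens (zhb a) Y V) (same_refl (idm W))) _.
apply: lift_comp_cast; first exact/lift_idl/lift22E.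
by apply: lift_idr (lift22E _ _) _.
Qed.

Lemma hiW_tens a Y V W :
  hiW a (Y ⊗ V) W ≡ hiW a Y (R V ⊗ W) ∘ (idm Y ⊠ hiW a V W).
Proof.
apply: same_inverse (hbK _ _ _) _ (hbW_tens _ _ _ _).
by rewrite -compA (comp_eq1 (hiK _ _ _)) wh_eq1 // hiK.
Qed.

(** * The half-braiding of the dual *)

Lemma dual_hbE b Y W :
  dhW b Y W =
  evW (ca b) (R Y ⊗ ((ca b)^∨ ⊗ W)) ∘ ((idm (ca b)^∨ ⊠ hiW b Y ((ca b)^∨ ⊗ W))
    ∘ (idm (ca b)^∨ ⊠ (idm Y ⊠ coevW (ca b) W))).
Proof.
rewrite compA; apply: same_eq; apply: same_trans (same_castm _ _ _) _.
apply: lift_castm; apply: lift_comp_cast; last exact/lift_idl2/lift02E.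
apply: lift_comp_cast; first by apply: lift_idr (lift20E _ _) _; rewrite tensA.
by apply: lift_idr (lift_idl _ (lift22E _ _)) _.
Qed.

Lemma dual_hb_nat b Y Y' W (f : hom Y Y') :
  dhW b Y' W ∘ (idm (ca b)^∨ ⊠ (f ⊠ idm W)) =
  (fmor R f ⊠ idm ((ca b)^∨ ⊗ W)) ∘ dhW b Y W.
Proof.
rewrite !dual_hbE -!compA.
rewrite (wh_eq _ (esym (interchange _ _))) (comp_eq (wh_eq _ (hiW_nat _ _ _))).
by rewrite (comp_eq (lift20_nat _ _)).
Qed.

(** Sliding [coev] through creates a snake with the [ev] inside the dual half-braiding;
    straightening it leaves the inverse half-braiding. *)
Lemma dual_hb_coev b Y W :
  (idm (ca b) ⊠ dhW b Y W) ∘ coevW (ca b) (Y ⊗ W) =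
  hiW b Y ((ca b)^∨ ⊗ W) ∘ (idm Y ⊠ coevW (ca b) W).
Proof.
rewrite dual_hbE !whD -!compA -lift02_nat -(comp_eq (lift02_nat _ _)).
by rewrite (comp_eq1 (snakeW _ _ _)).
Qed.

(** Only the crossing with [Y] is unfolded on the right; the crossing with [V] then slides down to
    its [coev], where [dual_hb_coev] applies. *)
Lemma dual_hb_tens b Y V W :
  dhW b (Y ⊗ V) W ≡ (idm (R Y) ⊠ dhW b V W) ∘ dhW b Y (V ⊗ W).
Proof.
rewrite dual_hbE; apply: same_trans (same_comp _ (same_comp _ _)) _.
- by apply: same_lift20; rewrite R_tens -tensA.
- exact: same_tensm (same_refl _) (hiW_tens _ _ _ _).
- exact: same_tensm (same_refl _) (same_wh2 _ _ _).
rewrite [dhW b Y _]dual_hbE (comp_eq (esym (lift20_nat _ _))).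
rewrite (comp_eq (wh_eq _ (esym (lift22_nat _ _)))).
by rewrite (wh_eq _ (wh_eq _ (dual_hb_coev _ _ _))) whD -compA.
Qed.

(** This says that [coev] is a morphism of the centre from the unit to α ⊗ α^∨; the next lemma says
    the same of [ev] on β^∨ ⊗ β. *)
Lemma hb_dual_hb_coev a Y W :
  hbW a Y ((ca a)^∨ ⊗ W) ∘ ((idm (ca a) ⊠ dhW a Y W) ∘ coevW (ca a) (Y ⊗ W)) =
  idm Y ⊠ coevW (ca a) W.
Proof. by rewrite dual_hb_coev (comp_eq1 (hiK _ _ _)). Qed.

Lemma ev_dual_hb_hb b Y W :
  (idm (R Y) ⊠ evW (ca b) W) ∘ dhW b Y (ca b ⊗ W) ∘ (idm (ca b)^∨ ⊠ hbW b Y W) =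
  evW (ca b) (R Y ⊗ W).
Proof.
rewrite dual_hbE -!compA -(comp_eq (lift20_nat _ _)).
rewrite -(comp_eq (wh_eq _ (lift22_nat _ _))).
rewrite (comp_eq1 (wh_eq1 _ (wh_eq1 _ (snakeW _ _ _)))).
by rewrite wh_eq1 ?compm1 // hbK.
Qed.

Lemma zmorW a b Y W (f : hom (ca a) (ca b)) : @is_zmor _ R a b f ->
  (idm Y ⊠ (f ⊠ idm W)) ∘ hbW a Y W = hbW b Y W ∘ (f ⊠ idm (R Y ⊗ W)).
Proof.
move=> zf; apply: same_eq.
apply: same_trans (_ : ((idm Y ⊠ f) ∘ hb (zhb a) Y) ⊠ idm W ≡ _).
  by apply/same_sym/lift_comp; [apply: lift_idl | apply: lift22E].
rewrite zf; apply: lift_comp; first exact: lift22E.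
by apply: lift_idr (lift_refl _ _) _.
Qed.

Lemma zmorW_inv a b Y W (f : hom (ca a) (ca b)) : @is_zmor _ R a b f ->
  (f ⊠ idm (R Y ⊗ W)) ∘ hiW a Y W = hiW b Y W ∘ (idm Y ⊠ (f ⊠ idm W)).
Proof.
move=> /zmorW zf; rewrite -[RHS]compm1 -(hiK a Y W) -[RHS]compA.
by rewrite (comp_eq (zf _ _)) compA hbK comp1m.
Qed.

(** The dual of a central arrow is central: it turns into [g] at [coev], [g] passes the inverse
    half-braiding, and at [ev] it becomes the dual arrow again. *)
Lemma dual_hb_ldualm b b' Y W (g : hom (ca b') (ca b)) : @is_zmor _ R b' b g ->
  (idm (R Y) ⊠ (ldualm D g ⊠ idm W)) ∘ dhW b Y W =
  dhW b' Y W ∘ (ldualm D g ⊠ idm (Y ⊗ W)).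
Proof.
move=> zg; rewrite !dual_hbE -!compA -(comp_eq (lift20_nat _ _)).
rewrite -(comp_eq (wh_eq _ (lift22_nat _ _))).
rewrite (wh_eq _ (wh_eq _ (coev_ldualm _ _ _))).
rewrite -(comp_eq (wh_eq _ (zmorW_inv _ _ zg))).
by rewrite -!interchange -(comp_eq (interchange _ _)) (comp_eq (ev_ldualm _ _ _)).
Qed.


(** * The heap product in the centre *)

Definition heap_lift a b c Y W :
    hom (ca a ⊗ ((ca b)^∨ ⊗ (ca c ⊗ (R Y ⊗ W))))
        (Y ⊗ (ca a ⊗ ((ca b)^∨ ⊗ (ca c ⊗ W)))) :=
  hbW a Y _ ∘ ((idm (ca a) ⊠ dhW b Y _)
    ∘ (idm (ca a) ⊠ (idm (ca b)^∨ ⊠ hbW c Y W))).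

Lemma heap_hbE a b c Y W : heap_hb D a b c Y ⊠ idm W ≡ heap_lift a b c Y W.
Proof.
rewrite /heap_lift compA; apply: lift_castm; apply: lift_comp_cast.
  apply: lift_comp_cast.
    by apply: lift_idr _ erefl; apply: lift_idr (lift22E _ _) _.
  by apply: lift_idr _ erefl; apply: lift_idl; apply: lift22E.
by rewrite tensm_id; apply/lift_idl2/lift22E.
Qed.

Lemma lift_idl3 (X1 X2 X3 X Y W X' Y' : C) (f : hom X Y) (F : hom X' Y') :
  f ⊠ idm W ≡ F ->
  (idm (X1 ⊗ X2 ⊗ X3) ⊠ f) ⊠ idm W ≡ idm X1 ⊠ (idm X2 ⊠ (idm X3 ⊠ F)).
Proof. by move=> fF; apply: same_trans (lift_idl2 _ _ fF) (same_wh2 _ _ _). Qed.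

Lemma heap_lift_nat a b c Y Y' W (f : hom Y Y') :
  heap_lift a b c Y' W
    ∘ (idm (ca a) ⊠ (idm (ca b)^∨ ⊠ (idm (ca c) ⊠ (fmor R f ⊠ idm W)))) =
  (f ⊠ idm (ca a ⊗ ((ca b)^∨ ⊗ (ca c ⊗ W)))) ∘ heap_lift a b c Y W.
Proof.
rewrite /heap_lift -!compA (wh_eq _ (wh_eq _ (hbW_nat _ _ _))).
by rewrite (comp_eq (wh_eq _ (dual_hb_nat _ _ _))) (comp_eq (hbW_nat _ _ _)).
Qed.

(** Each of the three crossings splits in two; naturality in the free strand then moves the
    crossings with [Y] ahead of those with [V]. *)
Lemma heap_lift_tens a b c Y V W :
  heap_lift a b c (Y ⊗ V) W ≡
  (idm Y ⊠ heap_lift a b c V W) ∘ heap_lift a b c Y (R V ⊗ W).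
Proof.
have wh_same U := fun X X' X1 X1' (f : hom X X') (f1 : hom X1 X1') =>
  @same_tensm C U U X X' U U X1 X1' (idm U) f (idm U) f1 (same_refl _).
apply: same_trans (same_comp (hbW_tens _ _ _ _) (same_comp
  (wh_same _ _ _ _ _ _ _ (dual_hb_tens _ _ _ _))
  (wh_same _ _ _ _ _ _ _ (wh_same _ _ _ _ _ _ _ (hbW_tens _ _ _ _))))) _.
rewrite /heap_lift !whD -!compA -(comp_eq (lift22_nat _ _)).
by rewrite -(comp_eq (lift22_nat _ _)) -(comp_eq (wh_eq _ (lift22_nat _ _))).
Qed.

Lemma dual_hb_iso b Y : C_invertible D b -> is_iso (dual_hb D b Y).
Proof.
case=> jev jcoev; apply: iso_castm.
apply: iso_comp_cast; last by apply: iso_tensm (iso_idm _) jcoev.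
apply: iso_comp_cast; first by apply: iso_tensm jev (iso_idm _).
apply: iso_tensm (iso_idm _); apply: iso_tensm (iso_idm _) _.
exact: iso_inverse (hb_iso (zhb b) Y).
Qed.

Lemma hb_is_iso a Y : is_iso (hb (zhb a) Y).
Proof. by exists (hb_inv (zhb a) Y); apply: hb_iso. Qed.

Lemma heap_hb_iso a b c Y : C_invertible D b -> is_iso (heap_hb D a b c Y).
Proof.
move=> ib; apply: iso_castm; apply: iso_comp_cast.
  apply: iso_comp_cast; apply: iso_tensm (iso_idm _); apply: iso_tensm.
  - exact: hb_is_iso.
  - exact: iso_idm.
  - exact: iso_idm.
  - exact: dual_hb_iso.
apply: iso_tensm; last exact: hb_is_iso.
by apply: iso_tensm; apply: iso_idm.
Qed.

Lemma heap_product_exists a b c :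
  C_invertible D b -> exists d, is_heap_product D a b c d.
Proof.
move=> ib.
(* A half-braiding stores its inverse as data, while [heap_hb_iso] gives mere existence. *)
have inv Y := constructive_indefinite_description _ (heap_hb_iso a c Y ib).
unshelve eexists (ZObj (@HalfBraiding C R (heap_carrier D a b c)
  (heap_hb D a b c) (fun Y => sval (inv Y)) (fun Y => svalP (inv Y)) _ _)).
- move=> Y Y' f; apply: eq_lift.
  + by apply: lift_comp (heap_hbE _ _ _ _ _) (lift_idl3 _ _ _ (lift_refl _ _)).
  + apply: lift_comp (heap_hbE _ _ _ _ _).
    by apply: lift_idr (lift_refl _ _) _; rewrite /heap_carrier -!tensA.
  + by rewrite heap_lift_nat.
- move=> Y V; apply: same_lift (heap_hbE _ _ _ _ _) _.
  apply: same_trans _ (same_sym (heap_lift_tens _ _ _ _ _ _)).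
  apply: lift_comp_cast; first exact/lift_idl/heap_hbE.
  by apply: lift_idr (heap_hbE _ _ _ _ _) _.
- by eexists; split; last reflexivity.
Qed.

Lemma C_invertible_ob a : C_invertible D a -> invertible_ob (ca a).
Proof.
case=> jev jcoev; exists (ca a)^∨; split; first by exists (evl D (ca a)).
by apply: isomorphic_sym; exists (coevl D (ca a)).
Qed.

(** Invertibility passes to [invertible_ob], is multiplied there, and returns to [ev] and [coev] of
    the product through [invertible_ev_iso] and [invertible_coev_iso]. *)
Lemma heap_product_invertible a b c d :
  is_heap_product D a b c d -> C_invertible D a -> C_invertible D b ->
  C_invertible D c -> C_invertible D d.
Proof.
case=> s [_ ->] /C_invertible_ob ia ib /C_invertible_ob ic.
have ib' : invertible_ob (ca b)^∨.
  exists (ca b); case: (C_invertible_ob ib); case: ib => jev jcoev _ _.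
  split; last by exists (evl D (ca b)).
  by apply: isomorphic_sym; exists (coevl D (ca b)).
have id_ := invertible_tens (invertible_tens ia ib') ic.
by split; [apply: invertible_ev_iso | apply: invertible_coev_iso].
Qed.

Lemma isomorphicE a b : @isomorphic Z a b ->
  exists2 f : hom (ca a) (ca b), @is_zmor _ R a b f & is_iso f.
Proof.
case=> -[f zf] [[g zg] [gf fg]]; exists f => //; exists g.
by split; [have := f_equal sval gf | have := f_equal sval fg].
Qed.

Lemma isomorphic_zmor a b (f : hom (ca a) (ca b)) :
  @is_zmor _ R a b f -> is_iso f -> @isomorphic Z a b.
Proof.
move=> zf [g [gf fg]].
have zg : @is_zmor _ R b a g.
  (* Whiskered [f] is monic, so centrality of the inverse may be tested after composing with it. *)
  move=> Y; apply: (@iso_monic _ _ _ _ (idm Y ⊠ f)).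
    by apply: iso_tensm (iso_idm _) _; exists g.
  rewrite compA -whD fg tensm_id comp1m compA zf -compA -whDr fg tensm_id.
  by rewrite compm1.
by exists (exist _ f zf), (exist _ g zg); split; apply: zhom_eq.
Qed.

Lemma isomorphic_same_hb a b :
  ca a = ca b -> (forall Y, hb (zhb a) Y ≡ hb (zhb b) Y) -> @isomorphic Z a b.
Proof.
case: a b => A s [B t] /= e; case: _ / e t => t st.
apply: (@isomorphic_zmor (ZObj s) (ZObj t) (idm A)); last exact: iso_idm.
by move=> Y; rewrite !tensm_id comp1m compm1; apply/same_eq/st.
Qed.

(** * Heap laws up to isomorphism in the centre *)

Lemma heap_product_unitl a c d :
  C_invertible D a -> is_heap_product D a a c d -> @isomorphic Z c d.
Proof.
move=> [_ jcoev] [s [sE ->]].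
pose K : hom (ca c) (heap_carrier D a a c) :=
  castm (coevl D (ca a) ⊠ idm (ca c)) (tens1o _) erefl.
have KE W : K ⊠ idm W ≡ coevW (ca a) (ca c ⊗ W).
  by apply: lift_castm; apply: lift_idr (lift02E _ _) _.
apply: (@isomorphic_zmor c (ZObj s) K).
  move=> Y; rewrite /= sE; apply: eq_lift.
  + exact: lift_comp (lift_idl _ (KE _)) (lift22E _ _).
  + exact: lift_comp (heap_hbE _ _ _ _ _) (lift_idr (KE _) erefl).
  rewrite /heap_lift -!compA -lift02_nat -hb_dual_hb_coev -!compA.
  by [].
by apply: iso_castm; apply: iso_tensm jcoev (iso_idm _).
Qed.

Lemma heap_product_unitr a b d :
  C_invertible D b -> is_heap_product D a b b d -> @isomorphic Z d a.
Proof.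
move=> [jev _] [s [sE ->]].
pose K : hom (heap_carrier D a b b) (ca a) :=
  castm (idm (ca a) ⊠ evl D (ca b)) (tensA _ _ _) (tenso1 _).
have KE W : K ⊠ idm W ≡ idm (ca a) ⊠ evW (ca b) W.
  by apply: lift_castm; apply: lift_idl (lift20E _ _).
apply: (@isomorphic_zmor (ZObj s) a K).
  move=> Y; rewrite /= sE; apply: eq_lift.
  + exact: lift_comp (lift_idl _ (KE _)) (heap_hbE _ _ _ _ _).
  + exact: lift_comp (lift22E _ _) (lift_idr (KE _) erefl).
  by rewrite /heap_lift (comp_eq (esym (lift22_nat _ _))) -!whD compA ev_dual_hb_hb.
by apply: iso_castm; apply: iso_tensm (iso_idm _) jev.
Qed.

Lemma heap_productW a b c d : is_heap_product D a b c d ->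
  forall Y W, hbW d Y W ≡ heap_lift a b c Y W.
Proof.
case=> s [sE ->] Y W; apply: same_trans (same_castm _ _ _) _.
by rewrite /= sE; apply: heap_hbE.
Qed.

Lemma heap_productE a b c d : is_heap_product D a b c d ->
  ca d = heap_carrier D a b c /\ forall Y, hb (zhb d) Y ≡ heap_hb D a b c Y.
Proof. by case=> s [sE ->]; split=> // Y; rewrite /= sE. Qed.

Lemma heap_product_assoc g h i j k d1 d2 d3 d4 :
  is_heap_product D i j k d1 -> is_heap_product D g h d1 d2 ->
  is_heap_product D g h i d3 -> is_heap_product D d3 j k d4 ->
  @isomorphic Z d2 d4.
Proof.
move=> P1 /heap_productE [e2 E2] P3 /heap_productE [e4 E4].
have [[e1 _] [e3 _]] := (heap_productE P1, heap_productE P3).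
apply: isomorphic_same_hb => [|Y].
  by rewrite e2 e4 /heap_carrier e1 e3 /heap_carrier !tensA.
apply: same_trans (E2 Y) (same_trans _ (same_sym (E4 Y))).
apply: same_lift (heap_hbE _ _ _ _ _) _.
apply: same_trans (heap_hbE _ _ _ _ _) _.
(* Expand the crossing of ⟨g,h,i⟩ into three; the whiskerings by its carrier split accordingly. *)
apply: same_trans (same_comp (heap_productW P3 _ _) (same_comp _ _)) _.
- by rewrite e3; apply: same_trans (same_wh2 _ _ _) (same_wh2 _ _ _).
- by rewrite e3; apply: same_trans (same_wh2 _ _ _) (same_wh2 _ _ _).
apply: same_sym.
(* On the other side, the carrier of ⟨i,j,k⟩ in the free strand is opened up. Both sides become the
   same chain of five crossings. *)
have eW W : ca d1 ⊗ W = ca i ⊗ ((ca j)^∨ ⊗ (ca k ⊗ W)).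
  by rewrite e1 /heap_carrier !tensA.
apply: same_trans (same_comp (same_lift22 _ _) (same_comp
  (same_tensm (same_refl _) (same_lift22 _ _)) (same_tensm (same_refl _)
    (same_tensm (same_refl _) (heap_productW P1 _ _))))) _.
- by rewrite eW.
- by rewrite eW.
by rewrite /heap_lift !whD -!compA.
Qed.

Lemma heap_product_isomorphic a b c a' b' c' d d' :
  strict_rigid D ->
  is_heap_product D a b c d -> is_heap_product D a' b' c' d' ->
  @isomorphic Z a a' -> @isomorphic Z b b' -> @isomorphic Z c c' ->
  @isomorphic Z d d'.
Proof.
move=> strictD [s [sE ->]] [s' [sE' ->]].
(* Dualising reverses arrows, so [g] is taken from [b'] to [b]. *)
move=> /isomorphicE [f zf jf] /isomorphic_sym /isomorphicE [g zg jg].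
move=> /isomorphicE [k zk jk].
pose M : hom (heap_carrier D a b c) (heap_carrier D a' b' c') :=
  (f ⊠ idm (ca b')^∨ ⊠ idm (ca c')) ∘ ((idm (ca a) ⊠ ldualm D g ⊠ idm (ca c'))
    ∘ (idm (ca a ⊗ (ca b)^∨) ⊠ k)).
pose F W := (f ⊠ idm ((ca b')^∨ ⊗ (ca c' ⊗ W)))
  ∘ ((idm (ca a) ⊠ (ldualm D g ⊠ idm (ca c' ⊗ W)))
    ∘ (idm (ca a) ⊠ (idm (ca b)^∨ ⊠ (k ⊠ idm W)))).
have ME W : M ⊠ idm W ≡ F W.
  apply: lift_comp; first by apply: lift_idr (lift_idr (lift_refl _ _) _) erefl.
  apply: lift_comp; last exact: lift_idl2 (lift_refl _ _).
  by apply: lift_idr (lift_idl _ (lift_refl _ _)) _.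
apply: (@isomorphic_zmor (ZObj s) (ZObj s') M).
  move=> Y; rewrite /= sE sE'; apply: eq_lift.
  + exact: lift_comp (lift_idl _ (ME _)) (heap_hbE _ _ _ _ _).
  + exact: lift_comp (heap_hbE _ _ _ _ _) (lift_idr (ME _) erefl).
  rewrite /heap_lift /F !whD -!compA.
  (* The arrows [k], [ldualm D g] and [f] pass in turn through the crossings of their own strands;
     [lift22_nat] and interchange move them past the rest. *)
  rewrite (comp_eq (esym (lift22_nat _ _))).
  rewrite (comp_eq (wh_eq _ (esym (lift22_nat _ _)))).
  rewrite (wh_eq _ (wh_eq _ (zmorW _ _ zk))).
  rewrite (comp_eq (esym (lift22_nat _ _))).
  rewrite (comp_eq (wh_eq _ (dual_hb_ldualm _ _ zg))).
  rewrite (comp_eq (zmorW _ _ zf)).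
  rewrite (comp_eq (wh_eq _ (interchange _ _))).
  by rewrite !(comp_eq (interchange _ _)).
by apply: iso_comp; [|apply: iso_comp]; repeat (apply: iso_tensm || exact: iso_idm
  || exact: ldualm_iso || done).
Qed.

(** * Isomorphism classes and the operation on them *)

Lemma pic_eq (S T : Pic D R) : sval S = sval T -> S = T.
Proof.
case: S T => S p [T q] /= e; case: _ / e q => q.
by rewrite (proof_irrelevance _ p q).
Qed.

(** Classes are predicates: equal ones both hold at [b], and conversely extensionality reduces
    equality to symmetry and transitivity of isomorphism. *)
Lemma pic_class_eq a b (ia : C_invertible D a) (ib : C_invertible D b) :
  pic_class ia = pic_class ib <-> @isomorphic Z a b.
Proof.
split=> [/(f_equal sval) /= e|ab].
  by have := isomorphic_refl b; rewrite -/(iso_class b b) -e.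
apply: pic_eq; apply: functional_extensionality => c; apply: propositional_extensionality.
by split; apply: isomorphic_trans => //; apply: isomorphic_sym.
Qed.

Lemma pic_classP (S : Pic D R) : exists a (ia : C_invertible D a), S = pic_class ia.
Proof.
case: S => S pS; case: (pS) => a [ia eS]; exists a, ia.
exact: pic_eq.
Qed.

(** A relation, since it allows any representatives; [heap_product_isomorphic] makes it
    single-valued. *)
Definition is_pic_product (S T U P : Pic D R) : Prop :=
  exists a b c d ia ib ic id_, is_heap_product D a b c d /\
    S = @pic_class _ D R a ia /\ T = @pic_class _ D R b ib /\
    U = @pic_class _ D R c ic /\ P = @pic_class _ D R d id_.

Lemma pic_product_exists (S T U : Pic D R) : exists P, is_pic_product S T U P.
Proof.
have [a [ia ->]] := pic_classP S; have [b [ib ->]] := pic_classP T.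
have [c [ic ->]] := pic_classP U; have [d P] := heap_product_exists a c ib.
have id_ := heap_product_invertible P ia ib ic.
by exists (pic_class id_), a, b, c, d, ia, ib, ic, id_.
Qed.

End Centre.

Theorem lemma4p9 (C : strict_monoidal_category) (D : rigid C)
    (strictD : strict_rigid D) (R : strict_monoidal_functor C C) :
  exists op : Pic D R -> Pic D R -> Pic D R -> Pic D R,
    (forall (a b c : twisted_centre R)
        (ha : C_invertible D a) (hb : C_invertible D b) (hc : C_invertible D c),
      exists (d : twisted_centre R) (hd : C_invertible D d),
        is_heap_product D a b c d
        /\ op (pic_class ha) (pic_class hb) (pic_class hc) = pic_class hd)
    /\ is_heap op.
Proof.
have ex (S T U : Pic D R) :=
  constructive_indefinite_description _ (pic_product_exists S T U).
pose op S T U := sval (ex S T U); exists op.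
(* The representatives behind the chosen value of [op] are only isomorphic to the given ones, so
   this is where independence of representatives enters. *)
have opE a b c d (ia : C_invertible D a) (ib : C_invertible D b)
    (ic : C_invertible D c) (jd : C_invertible D d) :
    is_heap_product D a b c d ->
    op (pic_class ia) (pic_class ib) (pic_class ic) = pic_class jd.
  move=> P; rewrite /op; case: (ex _ _ _) => Q /=.
  case=> [a1 [b1 [c1 [d1 [ia1 [ib1 [ic1 [jd1 [P1 [ea [eb [ec ->]]]]]]]]]]]].
  move: ea eb ec => /pic_class_eq aa1 /pic_class_eq bb1 /pic_class_eq cc1.
  apply/pic_class_eq.
  by apply: heap_product_isomorphic strictD P1 P _ _ _; apply: isomorphic_sym.
have opP a b c (ia : C_invertible D a) (ib : C_invertible D b)
    (ic : C_invertible D c) : exists d (jd : C_invertible D d),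
    is_heap_product D a b c d /\
    op (pic_class ia) (pic_class ib) (pic_class ic) = pic_class jd.
  have [d P] := heap_product_exists a c ib.
  have jd := heap_product_invertible P ia ib ic.
  by exists d, jd; split=> //; apply: opE.
(* With representatives for all classes, each heap law becomes an isomorphism between heap products
   in the centre. *)
split=> //; split=> [S1 S2 S3 S4 S5|S T].
  have [[g [ig ->]] [h [ih ->]]] := (pic_classP S1, pic_classP S2).
  have [[i [ii ->]] [j [ij ->]]] := (pic_classP S3, pic_classP S4).
  have [k [ik ->]] := pic_classP S5.
  have [d1 [jd1 [P1 ->]]] := opP _ _ _ ii ij ik.
  have [d2 [jd2 [P2 ->]]] := opP _ _ _ ig ih jd1.
  have [d3 [jd3 [P3 ->]]] := opP _ _ _ ig ih ii.
  have [d4 [jd4 [P4 ->]]] := opP _ _ _ jd3 ij ik.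
  by apply/pic_class_eq; apply: heap_product_assoc P1 P2 P3 P4.
have [[g [ig ->]] [h [ih ->]]] := (pic_classP S, pic_classP T).
have [d [jd [P ->]]] := opP _ _ _ ig ig ih.
have [d' [jd' [P' ->]]] := opP _ _ _ ih ig ig.
split; apply/pic_class_eq.
  by apply: isomorphic_sym; apply: heap_product_unitl ig P.
exact: heap_product_unitr ig P'.
Qed.
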